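(* Let $n\ge 1$, let $S$ be a Fibonacci set of rank $n$, and let the parameters $X,Y$ be generic. Then the cell module $V^S$ and the module $M_n^S$ are isomorphic as $O_n(X,Y)$-modules.
   Context: Generic Okada algebra. Let $K_0$ be a field of characteristic $0$, let $x_1,x_2,\dots,y_1,y_2,\dots$ be algebraically independent indeterminates over $K_0$, and let $K=K_0(x_1,x_2,\dots,y_1,y_2,\dots)$. $O_n=O_n(X,Y)$ is the associative unital $K$-algebra generated by $E_1,\dots,E_{n-1}$ with relations $E_i^2=x_iE_i$ ($1\le i\le n-1$), $E_iE_j=E_jE_i$ ($|i-j|\ge 2$), $E_{i+1}E_iE_{i+1}=y_iE_{i+1}$ ($1\le i\le n-2$). Okada arc diagrams. Order the vertices $1<2<\cdots<n<\overline n<\cdots<\overline 2<\overline 1$ and put $|i|=|\overline i|=i$; the vertices $i$ form the left boundary and the $\overline i$ the right boundary. An Okada arc diagram of rank $n$ is a noncrossing perfect matching of these $2n$ vertices (with respect to this order) in which each arc joining $a$ and $b$ has a height label $h\in\mathbb N$ with (i) $1\le h\le\min(|a|,|b|)$, (ii) $h\equiv\min(|a|,|b|)\pmod 2$, and (iii) if the arc $\{a,b\}$ is nested inside $\{c,d\}$ (that is, $c<a<b<d$) then the label of $\{a,b\}$ is strictly greater than that of $\{c,d\}$. An arc is propagating if it joins a left vertex to a right vertex. $\mathcal D_n$ is the set of Okada arc diagrams of rank $n$. For $d_1,d_2\in\mathcal D_n$, the composition $d_1\circ d_2$ is formed by placing $d_2$ to the right of $d_1$, identifying the vertex $\overline i$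 of $d_1$ with the vertex $i$ of $d_2$, and concatenating arcs; each resulting arc or loop gets the minimum of the labels of its fragments. $[d_1\circ d_2]\in\mathcal D_n$ is obtained by deleting closed loops. This makes $\mathcal D_n$ a monoid whose identity consists of the arcs $\{i,\overline i\}$ labelled $i$, and $[d_1\circ d_2\circ d_3]$ denotes the monoid product. The monoid is generated by $G_1,\dots,G_{n-1}$, where $G_i$ has propagating arcs $\{j,\overline j\}$ labelled $j$ for $j\ne i,i+1$ and arcs $\{i,i+1\}$ and $\{\overline i,\overline{i+1}\}$ both labelled $i$. $d^*$ is the mirror image of $d$ (interchange $i$ and $\overline i$ for all $i$, keeping labels). $\operatorname{PLab}(d)\subseteq\{1,\dots,n\}$ is the set of labels of the propagating arcs of $d$. The basis and the scalars $\lambda$. For $d\in\mathcal D_n$ take a word of minimal length with $d=[G_{i_1}\circ\cdots\circ G_{i_l}]$ and set $E_d=E_{i_1}\cdots E_{i_l}\in O_n$ (independent of the choice; $E_{\mathrm{id}}=1$). The $E_d$ ($d\in\mathcal D_n$) form a $K$-basis of $O_n$, and $E_{d_1}E_{d_2}=\lambda(d_1,d_2)E_{[d_1\circ d_2]}$ with $\lambda(d_1,d_2)\in K$ a monomial in the parameters. We identify $d$ with $E_d$ (so $G_i=E_i$); thus $O_n$ has basis $\mathcal D_n$ and product $d_1d_2=\lambda(d_1,d_2)[d_1\circ d_2]$. Fibonacci sets. A Fibonacci set of rank $n$ is a subset $S=\{s_1<\cdots<s_k\}\subseteq\{1,\dots,n\}$ with $k\equiv n\pmod 2$ and $s_i\equiv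 i\pmod 2$ for $1\le i\le k$. $\operatorname{PLab}(d)$ is a Fibonacci set of rank $n$ for every $d\in\mathcal D_n$. The modules $M_n^S$. For a Fibonacci set $S$ of rank $n$ let $I_n^S=\{t\in\mathcal D_n: t=t^*,\ \operatorname{PLab}(t)=S\}$, and let $M_n^S=KI_n^S$ be the $K$-vector space with basis $I_n^S$. It is an $O_n$-module under the $K$-bilinear extension of: for $d\in\mathcal D_n$, $t\in I_n^S$, $d\cdot t=\lambda(d,t)[d\circ t\circ d^*]$ if $\operatorname{PLab}([d\circ t\circ d^*])=S$, and $d\cdot t=0$ otherwise. Half diagrams and cell modules. Cutting $d\in\mathcal D_n$ vertically through its middle and keeping the left half gives the half arc diagram $|d\rangle$: it has vertices $1,\dots,n$, the labelled arcs of $d$ joining two left vertices, and, for each propagating arc of $d$, a half-arc attached to its left endpoint carrying the label of that arc. The Okada half arc diagrams of rank $n$ are those of the form $|d\rangle$, $d\in\mathcal D_n$, and $\operatorname{PLab}(|d\rangle)$ is the set of labels of its half-arcs (so $\operatorname{PLab}(|d\rangle)=\operatorname{PLab}(d)$). The cell module $V^S$ is the $K$-vector space with basis the half arc diagrams $|t\rangle$ of rank $n$ with $\operatorname{PLab}(|t\rangle)=S$, with the linear extension of the left action: for $d\in\mathcal D_n$, $d\bullet|t\rangle=\lambda(d,t)\,|[d\circ t]\rangle$ if $\operatorname{PLab}([d\circ t])=S$, and $d\bullet|t\rangle=0$ otherwise. This is independent of the choice of $t\in\mathcal D_n$ with the given left half. *)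

(* Defs.v *)
From mathcomp Require Import all_boot all_order all_algebra.
From mathcomp Require Import boolp classical_sets.
From mathcomp.multinomials Require Import mpoly.

Set Implicit Arguments.
Unset Strict Implicit.
Unset Printing Implicit Defensive.

Import GRing.Theory.
Local Open Scope ring_scope.

(* Indices start at 0 throughout: [x i], [y i] and [E i] stand for x_(i+1),   *)
(* y_(i+1) and E_(i+1), and [i : 'I_n] is the i-th vertex, with |i| = i + 1.  *)
(* Labels are not shifted.                                                    *)

(* The field K_0(x_1, x_2, ..., y_1, y_2, ...), characterised up to           *)
(* isomorphism as an extension of K_0 generated by algebraically independent  *)
(* families.                                                                  *)

Definition params (K : fieldType) (x y : nat -> K) (m : nat)
    (i : 'I_(m + m)) : K :=
  match split i with inl j => x j | inr j => y j end.

Definition alg_independent (K0 K : fieldType) (iota : {rmorphism K0 -> K})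
    (x y : nat -> K) : Prop :=
  forall (m : nat) (p : {mpoly K0[m + m]}),
    mmap iota (params x y (m := m)) p = 0 -> p = 0.

Definition generates_field (K0 K : fieldType) (iota : {rmorphism K0 -> K})
    (x y : nat -> K) : Prop :=
  forall c : K, exists (m : nat) (p q : {mpoly K0[m + m]}),
    mmap iota (params x y (m := m)) q != 0
    /\ c = mmap iota (params x y (m := m)) p / mmap iota (params x y (m := m)) q.

Definition generic_parameters (K0 K : fieldType) (iota : {rmorphism K0 -> K})
    (x y : nat -> K) : Prop :=
  alg_independent iota x y /\ generates_field iota x y.

(* Presentation of O_n: the relations hold, the E_i generate, and any family  *)
(* in another algebra that satisfies the relations is an image of the E_i.    *)

Definition okada_relations (K : fieldType) (x y : nat -> K) (n : nat)
    (A : algType K) (E : 'I_n.-1 -> A) : Prop :=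
  [/\ forall i : 'I_n.-1, E i * E i = x i *: E i,
      forall i j : 'I_n.-1, (i.+1 < j)%N -> E i * E j = E j * E i
    & forall i j : 'I_n.-1, j = i.+1 :> nat -> E j * E i * E j = y i *: E j].

Definition is_okada_algebra (K : fieldType) (x y : nat -> K) (n : nat)
    (O : algType K) (E : 'I_n.-1 -> O) : Prop :=
  [/\ okada_relations x y E,
      forall a : O, exists s : seq (K * seq 'I_n.-1),
        a = \sum_(cw <- s) cw.1 *: \prod_(i <- cw.2) E i
    & forall (B : algType K) (F : 'I_n.-1 -> B), okada_relations x y F ->
        exists f : {lrmorphism O -> B}, forall i, f (E i) = F i].

(* [inl i] is the left vertex i and [inr i] the right vertex i-bar.           *)

Notation vertex n := ('I_n + 'I_n)%type.

Definition height n (v : vertex n) : nat :=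
  match v with inl i => i.+1 | inr i => i.+1 end.

(* Position in the order 1 < ... < n < n-bar < ... < 1-bar.                   *)
Definition pos n (v : vertex n) : nat :=
  match v with inl i => i | inr i => (n + n - i.+1)%N end.

Definition flip n (v : vertex n) : vertex n :=
  match v with inl i => inr i | inr i => inl i end.

Definition is_right n (v : vertex n) : bool := if v is inr _ then true else false.

(* A labelled matching: each vertex is sent to the other end of its arc and   *)
(* to the label of its arc.                                                   *)
Notation diagram n :=
  ({ffun vertex n -> vertex n} * {ffun vertex n -> 'I_n.+1})%type.

Definition mate n (d : diagram n) (v : vertex n) : vertex n := d.1 v.
Definition lab n (d : diagram n) (v : vertex n) : 'I_n.+1 := d.2 v.

Definition perfect_matching n (d : diagram n) : bool :=
  [forall v, (mate d (mate d v) == v) && (mate d v != v)]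
  && [forall v, lab d (mate d v) == lab d v].

Definition noncrossing n (d : diagram n) : bool :=
  [forall a, forall c,
    ~~ [&& pos a < pos c, pos c < pos (mate d a)
         & pos (mate d a) < pos (mate d c)]%N].

Definition label_range n (d : diagram n) : bool :=
  [forall v, let m := minn (height v) (height (mate d v)) in
    [&& 1 <= lab d v, lab d v <= m & odd (lab d v) == odd m]%N].

Definition label_nesting n (d : diagram n) : bool :=
  [forall a, forall c,
    [&& pos c < pos a, pos a < pos (mate d a)
      & pos (mate d a) < pos (mate d c)]%N ==> (lab d c < lab d a)%N].

Definition is_okada n (d : diagram n) : bool :=
  [&& perfect_matching d, noncrossing d, label_range d & label_nesting d].

Definition mirror n (d : diagram n) : diagram n :=
  ([ffun v => flip (mate d (flip v))], [ffun v => lab d (flip v)]).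

Definition plab n (d : diagram n) : {set 'I_n.+1} :=
  [set lab d (inl i) | i : 'I_n & is_right (mate d (inl i))].

(* Composition: d1 and d2 are glued along the middle column, so the vertices  *)
(* are [inl (inl i)] (left), [inl (inr i)] (middle) and [inr i] (right).      *)
Section Composition.
Variables (n : nat) (d1 d2 : diagram n).

Notation glued := (vertex n + 'I_n)%type.

Definition from1 (v : vertex n) : glued := inl v.
Definition from2 (v : vertex n) : glued :=
  match v with inl i => inl (inr i) | inr i => inr i end.
Definition outer (v : vertex n) : glued :=
  match v with inl i => inl (inl i) | inr i => inr i end.

Definition fragment : rel glued := fun u v =>
  [exists a, (from1 a == u) && (from1 (mate d1 a) == v)]
  || [exists a, (from2 a == u) && (from2 (mate d2 a) == v)].

Definition comp_mate (v : vertex n) : vertex n :=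
  odflt v [pick w | (w != v) && connect fragment (outer v) (outer w)].

Definition comp_lab (v : vertex n) : nat :=
  minn (\big[minn/n]_(a | connect fragment (outer v) (from1 a)) lab d1 a)
       (\big[minn/n]_(a | connect fragment (outer v) (from2 a)) lab d2 a).

(* Closed loops do not meet the outer columns, hence are dropped.             *)
Definition comp : diagram n :=
  ([ffun v => comp_mate v], [ffun v => inord (comp_lab v)]).

End Composition.

Definition id_diag n : diagram n :=
  ([ffun v => flip v], [ffun v => inord (height v)]).

(* The two vertices i and i+1 on which G_i is not the identity.               *)
Definition gen_fst n (i : 'I_n.-1) : 'I_n := widen_ord (leq_pred n) i.

Lemma gen_snd_subproof n (i : 'I_n.-1) : (i.+1 < n)%N.
Proof. by rewrite -ltn_predRL. Qed.

Definition gen_snd n (i : 'I_n.-1) : 'I_n := Ordinal (gen_snd_subproof i).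

Definition gen_mate n (i : 'I_n.-1) (v : vertex n) : vertex n :=
  let sw (j : 'I_n) := if j == gen_fst i then Some (gen_snd i)
                       else if j == gen_snd i then Some (gen_fst i) else None in
  match v with
  | inl j => if sw j is Some k then inl k else inr j
  | inr j => if sw j is Some k then inr k else inl j
  end.

Definition gen_lab n (i : 'I_n.-1) (v : vertex n) : nat :=
  if height v == i.+2 then i.+1 else height v.

Definition gen n (i : 'I_n.-1) : diagram n :=
  ([ffun v => gen_mate i v], [ffun v => inord (gen_lab i v)]).

Definition word_diag n (w : seq 'I_n.-1) : diagram n :=
  foldr (fun i d => comp (gen i) d) (id_diag n) w.

Definition reduced_word n (d : diagram n) (w : seq 'I_n.-1) : Prop :=
  word_diag w = d /\ forall w', word_diag w' = d -> (size w <= size w')%N.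

Section OkadaBasis.
Variables (K : fieldType) (n : nat) (O : algType K) (E : 'I_n.-1 -> O).

(* E_d does not depend on the reduced word chosen by [xget].                  *)
Definition okada_elt (d : diagram n) : O :=
  \prod_(i <- xget [::] [set w | reduced_word d w]%classic) E i.

(* The E_d form a basis of O_n, so there is exactly one such scalar.          *)
Definition lambda (d1 d2 : diagram n) : K :=
  xget 0 [set c | okada_elt d1 * okada_elt d2 = c *: okada_elt (comp d1 d2)]%classic.

End OkadaBasis.

(* [enum S] is increasing, so [enum_val i] is s_(i+1). As s_1 is odd, such a  *)
(* set does not contain 0.                                                    *)
Definition fibonacci_set n (S : {set 'I_n.+1}) : bool :=
  (odd #|S| == odd n) && [forall i : 'I_#|S|, odd (enum_val i) == odd i.+1].

(* Half diagrams: [None] marks the half-arcs.                                 *)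

Notation half_diagram n :=
  ({ffun 'I_n -> option 'I_n} * {ffun 'I_n -> 'I_n.+1})%type.

Definition left_half n (d : diagram n) : half_diagram n :=
  ([ffun i => if mate d (inl i) is inl j then Some j else None],
   [ffun i => lab d (inl i)]).

Definition is_okada_half n (h : half_diagram n) : bool :=
  [exists d : diagram n, is_okada d && (left_half d == h)].

Definition plab_half n (h : half_diagram n) : {set 'I_n.+1} :=
  [set h.2 i | i : 'I_n & h.1 i == None].

Notation sym_index n S :=
  {t : diagram n | [&& is_okada t, t == mirror t & plab t == S]}.

Notation half_index n S :=
  {h : half_diagram n | is_okada_half h && (plab_half h == S)}.

(* The underlying spaces of M_n^S and V^S.                                    *)
Definition sym_space (K : fieldType) n (S : {set 'I_n.+1}) : lmodType K :=
  {ffun sym_index n S -> K^o}.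

Definition cell_space (K : fieldType) n (S : {set 'I_n.+1}) : lmodType K :=
  {ffun half_index n S -> K^o}.

Definition sym_vec (K : fieldType) n (S : {set 'I_n.+1}) (t : diagram n) :
    sym_space K S :=
  [ffun s : sym_index n S => (val s == t)%:R].

Definition cell_vec (K : fieldType) n (S : {set 'I_n.+1}) (h : half_diagram n) :
    cell_space K S :=
  [ffun s : half_index n S => (val s == h)%:R].

(* Left modules over a K-algebra with a given underlying K-space. Since the   *)
(* E_d span O_n, [is_sym_module] and [is_cell_module] each determine [act].   *)

Definition is_module_action (K : fieldType) (A : algType K) (W : lmodType K)
    (act : A -> W -> W) : Prop :=
  [/\ forall a (c : K) v w, act a (c *: v + w) = c *: act a v + act a w,
      forall (c : K) a b v, act (c *: a + b) v = c *: act a v + act b v,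
      forall v, act 1 v = v
    & forall a b v, act (a * b) v = act a (act b v)].

Definition is_sym_module (K : fieldType) n (O : algType K) (E : 'I_n.-1 -> O)
    (S : {set 'I_n.+1}) (act : O -> sym_space K S -> sym_space K S) : Prop :=
  is_module_action act /\
  forall d t : diagram n, is_okada d -> is_okada t -> t = mirror t -> plab t = S ->
    let dtd := comp (comp d t) (mirror d) in
    act (okada_elt E d) (sym_vec K S t) =
      if plab dtd == S then lambda E d t *: sym_vec K S dtd else 0.

Definition is_cell_module (K : fieldType) n (O : algType K) (E : 'I_n.-1 -> O)
    (S : {set 'I_n.+1}) (act : O -> cell_space K S -> cell_space K S) : Prop :=
  is_module_action act /\
  forall d t : diagram n, is_okada d -> is_okada t -> plab t = S ->
    let dt := comp d t in
    act (okada_elt E d) (cell_vec K S (left_half t)) =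
      if plab dt == S then lambda E d t *: cell_vec K S (left_half dt) else 0.

Definition module_isomorphic (K : fieldType) (A : algType K) (V W : lmodType K)
    (actV : A -> V -> V) (actW : A -> W -> W) : Prop :=
  exists f : {linear V -> W}, bijective f /\ forall a v, f (actV a v) = actW a (f v).

(* Main.v *)
(* Cutting in the middle is a bijection from the symmetric diagrams with       *)
(* propagating labels S onto the half diagrams with labels S: in a symmetric   *)
(* noncrossing diagram every propagating arc joins i to i-bar, so the diagram  *)
(* is recovered by unfolding its left half.  The induced linear bijection      *)
(* V^S -> M_n^S is equivariant.  As the E_i generate O_n, it is enough to      *)
(* compare the actions of E_i = E_{G_i} on basis vectors, where both carry the *)
(* scalar lambda(G_i, t); what remains is that for symmetric t the diagram     *)
(* G_i o t o G_i is the unfolding of the left half of G_i o t.  This is read   *)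
(* off an explicit description of the connected components of G_i o u.         *)

From HB Require Import structures.
From mathcomp Require Import all_boot all_order all_algebra.
From mathcomp Require Import zify.
From mathcomp Require classical_sets.
Require Import Defs.
Import GRing.Theory.
Local Open Scope ring_scope.

Set Implicit Arguments.
Unset Strict Implicit.
Unset Printing Implicit Defensive.

(** In a symmetric diagram an arc from [j] to the copy of [k] would cross its own mirror image if
    [j] and [k] differed, so propagating arcs are horizontal ([symmetric_straight]) and the diagram
    is the unfolding of its left half. Conversely, unfolding a half diagram gives an Okada diagram
    ([unfold_half_okada]); the label parity survives because both ends of a propagating arc have
    heights of the same parity ([propagating_parity]). This matches the two bases.

    For equivariance, [intertwining_generators] leaves the action of E_i on basis vectors. With the
    symmetric [t] as representative of its left half, both actions carry the same scalar, and the
    claim becomes the identity of diagrams [conj_gen]. It is obtained by computation: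
    [connect_component] lists the component of each outer vertex of G_i o u, which yields the
    formulas [cap_mate] and [cap_lab], and reflection turns right products by G_i into left ones
    ([comp_genr]). *)

Lemma connect_eq_mem (T : finType) (e : rel T) (C : {pred T}) x :
  x \in C -> (forall y z, y \in C -> e y z -> z \in C) ->
  (forall y, y \in C -> connect e x y) ->
  forall y, connect e x y = (y \in C).
Proof.
move=> xC closedC sC y; apply/idP/idP => [/connectP[p + ->]|]; last exact: sC.
elim: p x xC {sC} => [|z p IHp] x xC //= /andP[exz]; apply: IHp.
exact: closedC exz.
Qed.

Lemma bigmin_le (I : finType) (P : pred I) (F : I -> nat) b x :
  P x -> (\big[minn/b]_(y | P y) F y <= F x)%N.
Proof.
move=> Px; elim: (index_enum I) (mem_index_enum x) => // y r IHr.
rewrite in_cons big_cons => /orP[/eqP<-|/IHr]; first by rewrite Px geq_minl.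
by case: ifP => // _; rewrite geq_min orbC => ->.
Qed.

Lemma le_bigmin (I : finType) (P : pred I) (F : I -> nat) b m :
  (m <= b)%N -> (forall x, P x -> (m <= F x)%N) ->
  (m <= \big[minn/b]_(y | P y) F y)%N.
Proof.
by move=> mb mF; elim/big_ind: _ => // x y mx my; rewrite leq_min mx.
Qed.

(** The default [b] is not neutral for [minn] on [nat], so this is not a big operator over a monoid
    law; instead each side is shown to bound the other from below. *)
Lemma reindex_bigmin (I : finType) (f : I -> I) (P : pred I) (F : I -> nat) b :
  involutive f ->
  \big[minn/b]_(a | P a) F a = \big[minn/b]_(a | P (f a)) F (f a).
Proof.
have le_idx (Q : pred I) (G : I -> nat) : (\big[minn/b]_(a | Q a) G a <= b)%N.
  by elim/big_rec: _ => // a c _ cb; rewrite geq_min cb orbT.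
move=> fK; apply/eqP; rewrite eqn_leq; apply/andP; split; apply: le_bigmin => // a Pa.
  exact: (bigmin_le F).
by rewrite -(fK a); apply: (bigmin_le (F \o f)); rewrite fK.
Qed.

(** * Labelled matchings and left products by a generator *)

Section Diagrams.
Variable n : nat.
Implicit Types (d t u : diagram n) (v w a c : vertex n) (i : 'I_n.-1) (j k : 'I_n).

Lemma flipK : involutive (@flip n).
Proof. by case. Qed.

Lemma fragmentP d1 d2 x y :
  reflect (exists a, (x = from1 a /\ y = from1 (mate d1 a)) \/
                     (x = from2 a /\ y = from2 (mate d2 a)))
          (fragment d1 d2 x y).
Proof.
apply: (iffP orP) => [[]/existsP[a /andP[/eqP<- /eqP<-]]|[a []]].
- by exists a; left.
- by exists a; right.
- by case=> -> ->; left; apply/existsP; exists a; rewrite !eqxx.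
- by case=> -> ->; right; apply/existsP; exists a; rewrite !eqxx.
Qed.

Lemma from2_inj : injective (@from2 n).
Proof. by case=> [j|j] [k|k] //= []->. Qed.

Lemma from1_inj : injective (@from1 n).
Proof. by move=> ? ? []. Qed.

Lemma outer_inj : injective (@outer n).
Proof. by case=> [j|j] [k|k] //= []->. Qed.

(** A weakening of [is_okada] without planarity, nesting or parity: enough to compute products with
    [gen i], and stable under left products by [gen i] and under [mirror]. *)
Definition well_formed d : Prop :=
  [/\ involutive (mate d), forall v, mate d v != v,
      forall v, lab d (mate d v) = lab d v & forall v, (lab d v <= height v)%N].

Lemma okada_well_formed d : is_okada d -> well_formed d.
Proof.
case/and4P => /andP[/forallP dM /forallP dL] _ /forallP dR _; split=> v.
- by case/andP: (dM v) => /eqP.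
- by case/andP: (dM v).
- by apply/eqP/dL.
- by case/and3P: (dR v) => _ + _; lia.
Qed.

Lemma okada_noncrossing d a c : is_okada d -> (pos a < pos c)%N ->
  (pos c < pos (mate d a))%N -> (pos (mate d a) < pos (mate d c))%N -> False.
Proof.
case/and4P=> _ /forallP/(_ a)/forallP/(_ c)/negP H _ _ h1 h2 h3.
by apply: H; rewrite h1 h2 h3.
Qed.

Lemma okada_nesting d a c : is_okada d -> (pos c < pos a)%N ->
  (pos a < pos (mate d a))%N -> (pos (mate d a) < pos (mate d c))%N ->
  (lab d c < lab d a)%N.
Proof.
case/and4P=> _ _ _ /forallP/(_ a)/forallP/(_ c)/implyP H h1 h2 h3.
by apply: H; rewrite h1 h2 h3.
Qed.

Lemma mate_mirror d v : mate (mirror d) v = flip (mate d (flip v)).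
Proof. by rewrite /mate ffunE. Qed.

Lemma lab_mirror d v : lab (mirror d) v = lab d (flip v).
Proof. by rewrite /lab ffunE. Qed.

Lemma height_gt0 v : (0 < height v)%N.
Proof. by case: v. Qed.

Lemma height_le v : (height v <= n)%N.
Proof. by case: v => k /=; have := ltn_ord k. Qed.

Lemma pos_height v : pos v = if is_right v then (n + n - height v)%N else (height v).-1.
Proof. by case: v. Qed.

Lemma height_flip v : height (flip v) = height v.
Proof. by case: v. Qed.

Lemma is_right_flip v : is_right (flip v) = ~~ is_right v.
Proof. by case: v. Qed.

Lemma mirror_well_formed d : well_formed d -> well_formed (mirror d).
Proof.
case=> dK dN dL dH; split=> v; rewrite ?mate_mirror ?lab_mirror ?flipK //.
- by rewrite dK flipK.
- by apply: contra_neq (dN (flip v)) => {2}<-; rewrite flipK.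
- by rewrite -(height_flip v).
Qed.

Lemma diagram_eq d1 d2 : mate d1 =1 mate d2 -> lab d1 =1 lab d2 -> d1 = d2.
Proof.
by case: d1 d2 => [m1 l1] [m2 l2] /= em el; congr pair; apply/ffunP.
Qed.

Lemma mate_gen i v : mate (gen i) v = gen_mate i v.
Proof. by rewrite /mate ffunE. Qed.

Lemma lab_gen i v : lab (gen i) v = gen_lab i v :> nat.
Proof.
rewrite /lab ffunE inordK // /gen_lab; have := ltn_ord i.
by case: v => j /=; have := ltn_ord j; case: ifP; lia.
Qed.

Definition cup i : seq (vertex n) := [:: inl (gen_fst i); inl (gen_snd i)].

Definition swap_cup i v : vertex n :=
  if v == inl (gen_fst i) then inl (gen_snd i) else inl (gen_fst i).

Lemma gen_snd_neq i : (gen_snd i == gen_fst i) = false.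
Proof. by apply/eqP => /(congr1 val) /=; lia. Qed.

Lemma gen_fst_neq i : (gen_fst i == gen_snd i) = false.
Proof. by rewrite eq_sym gen_snd_neq. Qed.

Lemma eq_inl (j k : 'I_n) : (inl j == inl k :> vertex n) = (j == k).
Proof. by []. Qed.

Lemma gen_mate_cup i v : v \in cup i -> gen_mate i v = swap_cup i v.
Proof.
rewrite !inE /swap_cup => /orP[]/eqP->.
  by rewrite /= !eqxx.
by rewrite eq_inl /= gen_snd_neq eqxx.
Qed.

Lemma gen_mate_cupr i v : v \in cup i -> gen_mate i (flip v) = flip (swap_cup i v).
Proof.
rewrite !inE /swap_cup => /orP[]/eqP->.
  by rewrite /= !eqxx.
by rewrite eq_inl /= gen_snd_neq eqxx.
Qed.

Lemma gen_mateN i (j : 'I_n) : inl j \notin cup i ->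
  gen_mate i (inl j) = inr j /\ gen_mate i (inr j) = inl j.
Proof. by rewrite !inE !eq_inl negb_or => /andP[/negbTE /= -> /negbTE->]. Qed.

Lemma swap_cup_mem i v : swap_cup i v \in cup i.
Proof. by rewrite /swap_cup !inE; case: ifP; rewrite eqxx ?orbT. Qed.

Lemma swap_cupK i v : v \in cup i -> swap_cup i (swap_cup i v) = v.
Proof.
rewrite !inE /swap_cup => /orP[]/eqP->.
  by rewrite eqxx eq_inl gen_snd_neq.
by rewrite !eq_inl gen_snd_neq eqxx.
Qed.

Lemma swap_cup_neq i v : v \in cup i -> swap_cup i v != v.
Proof.
rewrite !inE /swap_cup => /orP[]/eqP->.
  by rewrite eqxx eq_inl gen_snd_neq.
by rewrite !eq_inl gen_snd_neq eq_inl gen_fst_neq.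
Qed.

Lemma cup_cases i v w : v \in cup i -> w \in cup i -> w = v \/ w = swap_cup i v.
Proof.
rewrite !inE /swap_cup => /orP[]/eqP-> /orP[]/eqP->; rewrite ?eqxx; auto.
by rewrite eq_inl gen_snd_neq; auto.
Qed.

(* [cap_mate i u] and [cap_lab i u] describe G_i o u: the arc {i, i+1} is new *)
(* and the former partners of i and i+1, if any, become joined.               *)
Definition cap_mate i u v : vertex n :=
  if v \in cup i then swap_cup i v
  else if mate u v \in cup i then mate u (swap_cup i (mate u v)) else mate u v.

Definition cap_lab i u v : nat :=
  if v \in cup i then i.+1
  else if mate u v \in cup i
  then minn (lab u (inl (gen_fst i))) (lab u (inl (gen_snd i)))
  else lab u v.

(* Outside its two short arcs G_i joins each vertex horizontally to its copy, *)
(* so an outer vertex v of the glued graph always comes with [from2 v].       *)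
Definition tail v : seq (vertex n + 'I_n) := [:: outer v; from2 v].

(** Off its short arcs G_i only runs along a tail, with the height as label. For a right vertex [v]
    this is vacuous, since the left factor has no vertex in the right column. *)
Lemma tail_from1 i v a : v \notin cup i -> from1 a \in tail v ->
  from1 (mate (gen i) a) \in tail v /\ lab (gen i) a = height v :> nat.
Proof.
move=> vN; rewrite lab_gen mate_gen /gen_lab; case: v vN => j jN; last first.
  by rewrite !inE.
have [e1 e2] := gen_mateN jN.
have ej : (j.+1 == i.+2) = false.
  by apply: contraNF jN => /eqP ej; rewrite !inE orbC eq_inl -val_eqE /=; lia.
by rewrite !inE /from1 => /orP[]/eqP[->]; rewrite ?e1 ?e2 /= ej ?eqxx ?orbT.
Qed.

Lemma tail_from2 v a : from2 a \in tail v -> a = v.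
Proof.
rewrite !inE => /orP[]/eqP; last exact: from2_inj.
by case: a v => [a|a] [v|v] //= [->].
Qed.

Lemma tail_outer v a : outer a \in tail v -> a = v.
Proof.
rewrite !inE => /orP[]/eqP; first exact: outer_inj.
by case: a v => [a|a] [v|v] //= [->].
Qed.

Lemma connect_tail i u v : v \notin cup i ->
  connect (fragment (gen i) u) (outer v) (from2 v) /\
  connect (fragment (gen i) u) (from2 v) (outer v).
Proof.
case: v => j jN //; have [e1 e2] := gen_mateN jN.
split; apply/connect1/fragmentP.
  by exists (inl j); left; rewrite mate_gen e1.
by exists (inr j); left; rewrite mate_gen e2.
Qed.

Lemma connect_from2 d u v :
  connect (fragment d u) (from2 v) (from2 (mate u v)).
Proof. by apply/connect1/fragmentP; exists v; right. Qed.

(** The vertices on the path from [outer v]: its tail, possibly the middle pair bridged by the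
    right-hand short arc of G_i, then the tail at the other end. *)
Definition component i u v : seq (vertex n + 'I_n) :=
  if v \in cup i then [:: outer v; outer (swap_cup i v)]
  else tail v ++
    (if mate u v \in cup i then [seq from2 w | w <- cup i] else [::]) ++
    tail (cap_mate i u v).

Section CapLeft.
Variables (i : 'I_n.-1) (u : diagram n).
Hypothesis uP : well_formed u.

Lemma cap_mateN v : v \notin cup i -> cap_mate i u v \notin cup i.
Proof.
case: uP => uK uN _ _ vN; rewrite /cap_mate (negbTE vN); case: ifPn => // uv.
have sv := swap_cup_mem i (mate u v).
apply/negP => w; case: (cup_cases sv w) => [e|].
  by have := uN (swap_cup i (mate u v)); rewrite e eqxx.
by rewrite swap_cupK // => /(can_inj uK) e; move: sv; rewrite e (negbTE vN).
Qed.

Lemma cap_mate_neq v : cap_mate i u v != v.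
Proof.
case: uP => uK uN _ _; rewrite /cap_mate; case: ifPn => vN; first exact: swap_cup_neq.
case: ifPn => // uv; apply/eqP => e.
by have /negP[] := swap_cup_neq uv; rewrite -{2}e uK.
Qed.

Lemma connect_component v x :
  connect (fragment (gen i) u) (outer v) x = (x \in component i u v).
Proof.
case: (uP) => uK uN uL uH.
rewrite /component; case: ifPn => vN.
  have sv := swap_cup_mem i v.
  have e w : w \in cup i -> outer w = from1 w by rewrite !inE => /orP[]/eqP->.
  rewrite !e //; apply: connect_eq_mem => [|y z|y].
  - by rewrite inE eqxx.
  - rewrite !inE => yv /fragmentP[a []] [ey ->]; move: yv; rewrite ey.
      by rewrite mate_gen => /orP[]/eqP/from1_inj->;
        rewrite gen_mate_cup ?swap_cupK ?eqxx ?orbT.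
    by move: vN sv; rewrite !inE => /orP[]/eqP-> /orP[]/eqP->; case: (a) => k /=.
  - rewrite !inE => /orP[]/eqP->; first exact: connect0.
    by apply/connect1/fragmentP; exists v; left; rewrite mate_gen gen_mate_cup.
have wN := cap_mateN vN; set w := cap_mate i u v in wN *.
have [v1 v2] := connect_tail u vN; have [w1 w2] := connect_tail u wN.
(* The path uses either two arcs of [u], turning at the right-hand short arc of G_i, or a single
   one. *)
move: (erefl w); rewrite {2}/w /cap_mate (negbTE vN); case: ifPn => uv ew.
  have su := swap_cup_mem i (mate u v).
  have cupE x' : (x' \in [seq from2 b | b <- cup i]) =
      (x' == from2 (mate u v)) || (x' == from2 (swap_cup i (mate u v))).
    apply/mapP/orP => [[b bc ->]|[]/eqP->]; last 2 first.
    - by exists (mate u v).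
    - by exists (swap_cup i (mate u v)).
    by case: (cup_cases uv bc) => ->; rewrite eqxx; auto.
  have e b : b \in cup i -> from2 b = from1 (flip b) by rewrite !inE => /orP[]/eqP->.
  have c1 := connect_from2 (gen i) u v.
  have c2 : connect (fragment (gen i) u) (from2 (mate u v)) (from2 (swap_cup i (mate u v))).
    rewrite !e //; apply/connect1/fragmentP; exists (flip (mate u v)); left.
    by rewrite mate_gen gen_mate_cupr.
  have := connect_from2 (gen i) u (swap_cup i (mate u v)); rewrite -ew => c3.
  apply: connect_eq_mem => [|y z|y]; rewrite !mem_cat !cupE.
  - by rewrite inE eqxx.
  - move=> + /fragmentP[a []] [ey ->]; rewrite ey => /or3P[|/orP[]|].
    + by case/(tail_from1 vN)=> ->.
    + rewrite e // => /eqP/from1_inj ->; rewrite mate_gen gen_mate_cupr // -e ?swap_cup_mem //.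
      by rewrite eqxx !orbT.
    + rewrite e // => /eqP/from1_inj ->; rewrite mate_gen gen_mate_cupr // swap_cupK // -e //.
      by rewrite eqxx !orbT.
    + by case/(tail_from1 wN)=> ->; rewrite !orbT.
    + by move/tail_from2->; rewrite eqxx !orbT.
    + by move/eqP/from2_inj->; rewrite uK !inE eqxx !orbT.
    + by move/eqP/from2_inj->; rewrite -ew !inE eqxx !orbT.
    + by move/tail_from2->; rewrite ew uK eqxx !orbT.
  - have cm := connect_trans v1 c1; have cs := connect_trans cm c2.
    have cw := connect_trans cs c3.
    rewrite !inE => /or3P[|/orP[]|] => [/orP[]|||/orP[]] /eqP-> //.
    exact: connect_trans cw w2.
rewrite cat0s.
have := connect_from2 (gen i) u v; rewrite -ew => c1.
apply: connect_eq_mem => [|y z|y]; rewrite !mem_cat.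
- by rewrite inE eqxx.
- move=> + /fragmentP[a []] [ey ->]; rewrite ey => /orP[].
  + by case/(tail_from1 vN)=> ->.
  + by case/(tail_from1 wN)=> ->; rewrite !orbT.
  + by move/tail_from2->; rewrite -ew !inE eqxx !orbT.
  + by move/tail_from2->; rewrite ew uK !inE eqxx !orbT.
- have cw := connect_trans v1 c1.
  rewrite !inE => /orP[] /orP[]/eqP-> //.
  exact: connect_trans cw w2.
Qed.

(** Each outer vertex has exactly one partner, so the [pick] in [comp_mate] has no choice. *)
Lemma connect_outer v w :
  (w != v) && connect (fragment (gen i) u) (outer v) (outer w) =
  (w == cap_mate i u v).
Proof.
rewrite connect_component; apply/andP/eqP => [[wv]|->]; last first.
  split; first exact: cap_mate_neq.
  rewrite /component; case: ifPn => vN; first by rewrite !inE /cap_mate vN eqxx orbT.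
  by rewrite !mem_cat !inE eqxx !orbT.
rewrite /component; case: ifPn => vN.
  rewrite /cap_mate vN !inE => /orP[]/eqP/outer_inj // e.
  by rewrite e eqxx in wv.
rewrite !mem_cat => /or3P[/tail_outer e||/tail_outer//].
  by rewrite e eqxx in wv.
case: ifP => // _ /mapP[b]; rewrite !inE => /orP[]/eqP-> /=; by case: (w).
Qed.

(** Off the cup only arcs of [u] decide the minimum: a horizontal line of G_i is labelled by its
    height, which bounds the label of [u] there, and the bridging arc has label [i.+1], the height
    of [gen_fst i]. On the left short arc no vertex of [u] occurs, and the second minimum is its
    default [n]. *)
Lemma comp_lab_gen v : comp_lab (gen i) u v = cap_lab i u v.
Proof.
case: (uP) => uK uN uL uH; rewrite /comp_lab.
set m1 := bigop _ _ _; set m2 := bigop _ _ _.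
have le1 a m : from1 a \in component i u v -> (lab (gen i) a <= m)%N -> (m1 <= m)%N.
  by rewrite -connect_component => ca; apply/leq_trans/(bigmin_le (fun a => lab (gen i) a : nat)).
have le2 a m : from2 a \in component i u v -> (lab u a <= m)%N -> (m2 <= m)%N.
  by rewrite -connect_component => ca; apply/leq_trans/(bigmin_le (fun a => lab u a : nat)).
have ge1 m : (m <= n)%N ->
    (forall a, from1 a \in component i u v -> (m <= lab (gen i) a)%N) -> (m <= m1)%N.
  by move=> mn H; apply: le_bigmin => // a; rewrite connect_component; apply: H.
have ge2 m : (m <= n)%N ->
    (forall a, from2 a \in component i u v -> (m <= lab u a)%N) -> (m <= m2)%N.
  by move=> mn H; apply: le_bigmin => // a; rewrite connect_component; apply: H.
have lab_le a : (lab u a <= n)%N by have := ltn_ord (lab u a); lia.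
have lt_in := ltn_ord i.
have lab_cup a :
    from1 a \in [seq from1 b | b <- cup i] ++ [seq from2 b | b <- cup i] ->
    lab (gen i) a = i.+1 :> nat.
  by rewrite /= lab_gen /gen_lab !inE => /or4P[]/eqP[->] /=; case: eqP => //; lia.
rewrite /cap_lab; move: le1 le2 ge1 ge2; rewrite /component; case: ifPn => vN le1 le2 ge1 ge2.
  have e w : w \in cup i -> outer w = from1 w by rewrite !inE => /orP[]/eqP->.
  have e2 a w : w \in cup i -> from2 a != outer w by rewrite !inE => /orP[]/eqP->; case: a.
  have sv := swap_cup_mem i v.
  apply/eqP; rewrite eqn_leq leq_min geq_min; apply/and3P; split.
  - apply/orP; left; apply: (le1 v); first by rewrite inE e ?eqxx.
    by rewrite lab_cup // mem_cat map_f.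
  - apply: ge1 => [|a]; first by lia.
    rewrite !e // !inE => /orP[]/eqP/from1_inj->; by rewrite lab_cup // mem_cat map_f.
  - by apply: ge2 => [|a]; [lia|rewrite !inE !(negbTE (e2 _ _ _))].
have wN := cap_mateN vN.
move: wN le1 le2 ge1 ge2; rewrite /cap_mate (negbTE vN); case: ifPn => uv wN le1 le2 ge1 ge2.
  have -> : minn (lab u (inl (gen_fst i))) (lab u (inl (gen_snd i))) =
     minn (lab u (mate u v)) (lab u (swap_cup i (mate u v))).
    move: (uv); rewrite !inE => /orP[]/eqP->; rewrite /swap_cup.
      by rewrite eqxx.
    by rewrite eq_inl gen_snd_neq minnC.
  have su := swap_cup_mem i (mate u v).
  have hcup : (minn (lab u (mate u v)) (lab u (swap_cup i (mate u v))) <= i.+1)%N.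
    move: uv; rewrite !inE => /orP[]/eqP->; rewrite /swap_cup ?eqxx ?eq_inl ?gen_snd_neq.
      by have /= := uH (inl (gen_fst i)); rewrite geq_min => ->.
    by have /= := uH (inl (gen_fst i)); rewrite geq_min orbC => ->.
  apply/eqP; rewrite eqn_leq geq_min !leq_min; apply/and3P; split.
  - apply/orP; right; apply/andP; split.
      by apply: (le2 (mate u v)) => //; rewrite !mem_cat map_f ?orbT.
    by apply: (le2 (swap_cup i (mate u v))) => //; rewrite !mem_cat map_f ?orbT.
  - apply: ge1 => [|a]; first by rewrite geq_min lab_le.
    rewrite !mem_cat => /or3P[||].
    + by case/(tail_from1 vN) => _ ->; rewrite geq_min uL uH.
    + by move=> ac; rewrite lab_cup ?mem_cat ?ac ?orbT.
    + by case/(tail_from1 wN) => _ ->; rewrite geq_min -(uL (swap_cup i _)) uH orbT.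
  - apply: ge2 => [|a]; first by rewrite geq_min lab_le.
    rewrite !mem_cat => /or3P[|/mapP[b bc /from2_inj->]|].
    + by move/tail_from2->; rewrite geq_min uL ?leqnn.
    + by case: (cup_cases uv bc) => ->; rewrite geq_min leqnn ?orbT.
    + by move/tail_from2->; rewrite geq_min (uL (swap_cup i _)) leqnn orbT.
apply/eqP; rewrite eqn_leq geq_min !leq_min; apply/and3P; split.
- by apply/orP; right; apply: (le2 v); rewrite // !inE eqxx orbT.
- apply: ge1 => // a; rewrite mem_cat => /orP[].
    by case/(tail_from1 vN) => _ ->.
  by case/(tail_from1 wN) => _ ->; rewrite -uL.
- apply: ge2 => // a; rewrite mem_cat => /orP[] /tail_from2-> //.
  by rewrite uL.
Qed.

Lemma cap_lab_le v : (cap_lab i u v <= height v)%N.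
Proof.
case: (uP) => uK uN uL uH; rewrite /cap_lab; case: ifPn => vN.
  by move: vN; rewrite !inE => /orP[]/eqP-> /=; lia.
case: ifPn => uv //; have := uH v; rewrite -uL => h.
by move: uv h; rewrite !inE geq_min => /orP[]/eqP-> -> //; rewrite orbT.
Qed.

Lemma mate_comp_gen v : mate (comp (gen i) u) v = cap_mate i u v.
Proof.
rewrite /mate ffunE /comp_mate; case: pickP => [w|/(_ (cap_mate i u v))].
  by rewrite connect_outer => /eqP.
by rewrite connect_outer eqxx.
Qed.

Lemma lab_comp_gen v : lab (comp (gen i) u) v = cap_lab i u v :> nat.
Proof.
rewrite /lab ffunE comp_lab_gen inordK //.
by have := cap_lab_le v; have := height_le v; lia.
Qed.

Lemma comp_gen_well_formed : well_formed (comp (gen i) u).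
Proof.
case: (uP) => uK uN uL uH; split=> v.
- rewrite !mate_comp_gen; have [vC|vN] := boolP (v \in cup i).
    by rewrite {2}/cap_mate vC /cap_mate swap_cup_mem swap_cupK.
  rewrite {1}/cap_mate (negbTE (cap_mateN vN)).
  rewrite /cap_mate (negbTE vN); case: (ifPn (mate u v \in _)) => uv; rewrite uK.
    by rewrite swap_cup_mem swap_cupK // uK.
  by rewrite (negbTE vN).
- by rewrite mate_comp_gen cap_mate_neq.
- apply: val_inj; rewrite /= !lab_comp_gen mate_comp_gen.
  have [vC|vN] := boolP (v \in cup i).
    by rewrite /cap_mate /cap_lab vC swap_cup_mem.
  rewrite /cap_lab (negbTE (cap_mateN vN)).
  rewrite /cap_mate (negbTE vN); case: (ifPn (mate u v \in _)) => uv; rewrite uK.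
    by rewrite swap_cup_mem.
  by rewrite (negbTE vN) uL.
- by rewrite lab_comp_gen cap_lab_le.
Qed.

End CapLeft.
End Diagrams.
Arguments flipK {n}.

(** * Reflection and unfolding *)

Section Mirror.
Variable n : nat.
Implicit Types (d t u : diagram n) (v w a c : vertex n) (i : 'I_n.-1) (j k : 'I_n).

Definition reflect_glued (x : vertex n + 'I_n) : vertex n + 'I_n :=
  match x with
  | inl (inl j) => inr j
  | inl (inr j) => inl (inr j)
  | inr j => inl (inl j)
  end.

Lemma reflect_gluedK : involutive reflect_glued.
Proof. by case=> [[]|]. Qed.

Lemma reflect_from1 v : reflect_glued (from1 v) = from2 (flip v).
Proof. by case: v. Qed.

Lemma reflect_from2 v : reflect_glued (from2 v) = from1 (flip v).
Proof. by case: v. Qed.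

Lemma reflect_outer v : reflect_glued (outer v) = outer (flip v).
Proof. by case: v. Qed.

Lemma mirrorK : involutive (@mirror n).
Proof.
by move=> d; apply: diagram_eq => v; rewrite ?mate_mirror ?lab_mirror ?flipK.
Qed.

Lemma fragment_reflect d1 d2 x y :
  fragment d1 d2 x y ->
  fragment (mirror d2) (mirror d1) (reflect_glued x) (reflect_glued y).
Proof.
case/fragmentP=> a [] [-> ->]; apply/fragmentP; exists (flip a);
  rewrite !mate_mirror flipK ?reflect_from1 ?reflect_from2; by auto.
Qed.

Lemma connect_reflect d1 d2 x y :
  connect (fragment d1 d2) x y =
  connect (fragment (mirror d2) (mirror d1)) (reflect_glued x) (reflect_glued y).
Proof.
have homo e1 e2 x' y' : connect (fragment e1 e2) x' y' ->
  connect (fragment (mirror e2) (mirror e1)) (reflect_glued x') (reflect_glued y').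
  case/connectP=> p + ->; elim: p x' => [|z p IHp] x' /=; first by rewrite connect0.
  case/andP=> /fragment_reflect/connect1 xz /IHp; exact: connect_trans.
apply/idP/idP => [|/homo]; first exact: homo.
by rewrite !mirrorK !reflect_gluedK.
Qed.

Lemma comp_lab_mirror d1 d2 v :
  comp_lab d1 d2 v = comp_lab (mirror d2) (mirror d1) (flip v).
Proof.
rewrite /comp_lab minnC; congr minn; rewrite [RHS](reindex_bigmin _ _ _ flipK);
  apply: eq_big => [w|w _]; rewrite ?lab_mirror ?flipK //; rewrite connect_reflect reflect_outer.
  by rewrite reflect_from2.
by rewrite reflect_from1.
Qed.

Lemma mirror_gen i : mirror (gen i) = gen i.
Proof.
apply: diagram_eq => v; last first.
  by apply: val_inj; rewrite /= lab_mirror !lab_gen /gen_lab height_flip.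
rewrite mate_mirror !mate_gen.
by case: v => j /=; case: ifP => // _; case: ifP.
Qed.

(** Reflecting the glued graph exchanges the two factors, and [gen i] is its own mirror image.
    Well-formedness gives the unique partner that [comp_mate] must pick. *)
Lemma comp_genr i u : well_formed u ->
  comp u (gen i) = mirror (comp (gen i) (mirror u)).
Proof.
move=> uP; have mP := mirror_well_formed uP; apply: diagram_eq => v; last first.
  by rewrite lab_mirror /lab !ffunE comp_lab_mirror mirror_gen.
have co w : (w != v) && connect (fragment u (gen i)) (outer v) (outer w) =
    (flip w == mate (comp (gen i) (mirror u)) (flip v)).
  by rewrite mate_comp_gen // -connect_outer // (inj_eq (can_inj flipK)) connect_reflect
    !reflect_outer mirror_gen.
rewrite mate_mirror {1}/mate ffunE /comp_mate; case: pickP => [w|].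
  by rewrite co => /eqP<-; rewrite flipK.
by move/(_ (flip (mate (comp (gen i) (mirror u)) (flip v)))); rewrite co flipK eqxx.
Qed.

Definition unfold_half (h : half_diagram n) : diagram n :=
  ([ffun v => match v with
     | inl j => if h.1 j is Some k then inl k else inr j
     | inr j => if h.1 j is Some k then inr k else inl j
     end],
   [ffun v => match v with inl j | inr j => h.2 j end]).

Lemma mate_unfold d v : mate (unfold_half (left_half d)) v =
  match v with
  | inl j => if mate d (inl j) is inl k then inl k else inr j
  | inr j => if mate d (inl j) is inl k then inr k else inl j
  end.
Proof. by rewrite {1}/mate !ffunE; case: v => j; rewrite ffunE; case: (mate d (inl j)). Qed.

Lemma lab_unfold d v : lab (unfold_half (left_half d)) v =
  lab d (inl (match v with inl j | inr j => j end)).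
Proof. by rewrite {1}/lab !ffunE; case: v => j; rewrite ffunE. Qed.

Lemma left_half_unfold d : left_half (unfold_half (left_half d)) = left_half d.
Proof.
congr pair; apply/ffunP => j; rewrite !ffunE; last by rewrite lab_unfold.
by rewrite mate_unfold; case: (mate d (inl j)).
Qed.

Lemma mirror_unfold d :
  mirror (unfold_half (left_half d)) = unfold_half (left_half d).
Proof.
by apply: diagram_eq => -[] j; rewrite ?mate_mirror ?lab_mirror ?lab_unfold ?mate_unfold //=;
  case: (mate d (inl j)).
Qed.

Lemma plab_left_half d : plab_half (left_half d) = plab d.
Proof.
apply/setP => s; apply/imsetP/imsetP => -[j jP ->]; exists j;
  move: jP; rewrite ?inE /= ?ffunE //=; by case: (mate d (inl j)).
Qed.

Definition straight t := forall v, is_right (mate t v) != is_right v -> mate t v = flip v.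

Lemma unfold_left_half t : t = mirror t -> straight t -> unfold_half (left_half t) = t.
Proof.
move=> tM tS; apply: diagram_eq => -[] j; rewrite ?mate_unfold ?lab_unfold //.
- by have := tS (inl j); case: (mate t (inl j)) => //= k ->.
- rewrite {2}tM mate_mirror /=; have := tS (inl j).
  by case: (mate t (inl j)) => //= k /(_ isT) [->].
- by rewrite {2}tM lab_mirror.
Qed.

(** If [j] is joined to the copy of [k], then by symmetry [k] is joined to the copy of [j], and
    these arcs cross unless [j = k]. *)
Lemma symmetric_straight t : is_okada t -> t = mirror t -> straight t.
Proof.
move=> tO tM; have [tK _ _ _] := okada_well_formed tO.
have tF v : mate t (flip v) = flip (mate t v) by rewrite {1}tM mate_mirror flipK.
have tN a c := @okada_noncrossing _ t a c tO.
have H j k : mate t (inl j) = inr k -> k = j.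
  move=> e; have := tF (inl j); rewrite e /= => e1.
  have e2 : mate t (inl k) = inr j by rewrite -(tK (inr j)) e1.
  have := ltn_ord j; have := ltn_ord k => kn jn.
  case: (ltngtP k j) => [kj|jk|/val_inj//].
    by case: (tN (inl k) (inl j)); rewrite ?e ?e2 //=; clear -jn kn kj; lia.
  by case: (tN (inl j) (inl k)); rewrite ?e ?e2 //=; clear -jn kn jk; lia.
case=> j; first by case e: (mate t (inl j)) => [k|k] //= _; rewrite (H _ _ e).
case e: (mate t (inr j)) => [k|k] //= _.
by rewrite (H k j) // -e tK.
Qed.

(** * Conjugating a symmetric diagram by a generator *)

Section Conjugation.
Variables (i : 'I_n.-1) (t : diagram n).
Hypotheses (tP : well_formed t) (tM : t = mirror t) (tS : straight t).
Let u := comp (gen i) t.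

Let tF v : mate t (flip v) = flip (mate t v).
Proof. by rewrite {1}tM mate_mirror flipK. Qed.

Let tL v : lab t (flip v) = lab t v.
Proof. by rewrite {1}tM lab_mirror flipK. Qed.

Let inr_cup j : inr j \in cup i = false.
Proof. by rewrite !inE. Qed.

Let flip_cup v : v \in cup i -> flip v \in cup i = false.
Proof. by rewrite !inE => /orP[]/eqP->. Qed.

Let straight_r j : mate t (inr j) \in cup i -> mate t (inr j) = inl j.
Proof.
move=> h; apply: tS; move: h.
by rewrite !inE => /orP[]/eqP->.
Qed.

Let is_left_cup v : v \in cup i -> is_right v = false.
Proof. by rewrite !inE => /orP[]/eqP->. Qed.

(** Such a line starts in [t] with an arc from [j] to a cup vertex [c], is bridged to the other cup
    vertex and goes straight across. The mirror arc of [t] joins the copy of [c] to the copy of [j],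
    which is how the line returns through the right factor. *)
Let cap_mate_inl j k : cap_mate i t (inl j) = inr k -> k \in [:: gen_fst i; gen_snd i] ->
  let c := mate t (inl j) in
  [/\ inl j \notin cup i, c \in cup i, swap_cup i c = inl k & cap_mate i t (flip c) = inr j].
Proof.
have [tK _ _ _] := tP.
move=> + kc; rewrite /cap_mate; case: ifPn => jC.
  by move/(congr1 (@is_right n)); rewrite (is_left_cup (swap_cup_mem _ _)).
have kC : inl k \in cup i by move: kc; rewrite !inE.
case: ifPn => cC e /=; last first.
  have := tS (v := inl j); rewrite e => /(_ isT) [kj].
  by rewrite -kj kC in jC.
have sC := swap_cup_mem i (mate t (inl j)).
split=> //.
  apply: (can_inj flipK); rewrite -(tS (v := swap_cup i _)) ?e //.
  by rewrite (is_left_cup sC).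
by rewrite flip_cup // tF tK /= ?inr_cup.
Qed.

Lemma mate_conj_gen v :
  flip (cap_mate i (mirror u) (flip v)) = mate (unfold_half (left_half u)) v.
Proof.
have [tK _ _ _] := tP; have uE := mate_comp_gen i tP.
rewrite mate_unfold; case: v => j /=.
  rewrite /cap_mate inr_cup mate_mirror /= uE.
  case e: (cap_mate i t (inl j)) => [k|k] /=; first by rewrite ?inr_cup.
  case: ifPn => kC.
    have [jN cC sc e'] := cap_mate_inl e kC.
    by rewrite mate_mirror flipK -sc swap_cupK // uE e'.
  (* Here the line must be horizontal: one bridged through the cup would go straight across to the
     copy of a cup vertex. *)
  move: e; rewrite /cap_mate; case: ifPn => jC.
    by move/(congr1 (@is_right n)); rewrite (is_left_cup (swap_cup_mem _ _)).
  case: ifPn => cC e; last first.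
    by have := tS (v := inl j); rewrite e => /(_ isT) [->].
  have sC := swap_cup_mem i (mate t (inl j)).
  have := tS (v := swap_cup i (mate t (inl j))); rewrite e (is_left_cup sC) => /(_ isT) e'.
  by move: sC; rewrite -(flipK (swap_cup _ _)) -e' (negbTE kC).
rewrite uE /cap_mate; case: ifPn => jC.
  move: (is_left_cup (swap_cup_mem i (inl j))).
  by case: (swap_cup _ _).
rewrite mate_mirror /= !uE.
have -> : cap_mate i t (inr j) = flip (mate t (inl j)).
  rewrite /cap_mate inr_cup ifF; first exact: (tF (inl j)).
  by apply/negbTE/negP => h; move: (h); rewrite straight_r // (negbTE jC).
rewrite flipK; case: ifPn => cC.
  have sC := swap_cup_mem i (mate t (inl j)).
  rewrite mate_mirror flipK uE /cap_mate flip_cup // tF.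
  have := tS (v := swap_cup i (mate t (inl j))); rewrite (is_left_cup sC).
  case: (mate t (swap_cup i _)) => k /=; first by rewrite ?inr_cup.
  move=> /(_ isT) e; have -> : inl k = swap_cup i (mate t (inl j)).
    by rewrite -(flipK (swap_cup i _)) -e.
  by rewrite sC swap_cupK // tK.
have := tS (v := inl j).
by case: (mate t (inl j)) => k //= /(_ isT) [->].
Qed.

Lemma lab_conj_gen v :
  cap_lab i (mirror u) (flip v) = lab (unfold_half (left_half u)) v.
Proof.
have [tK _ _ _] := tP; have uE := mate_comp_gen i tP; have uL := lab_comp_gen i tP.
have cup_lab c : c \in cup i ->
  minn (lab t (inl (gen_fst i))) (lab t (inl (gen_snd i))) =
  minn (lab t c) (lab t (swap_cup i c)).
  rewrite !inE => /orP[]/eqP->; rewrite /swap_cup ?eqxx //.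
  by rewrite eq_inl gen_snd_neq minnC.
have [_ _ uLm _] := comp_gen_well_formed i tP.
rewrite lab_unfold; case: v => j /=.
  rewrite /cap_lab inr_cup mate_mirror !lab_mirror /= uE.
  case e: (cap_mate i t (inl j)) => [k|k] /=; first by rewrite ?inr_cup.
  case: ifPn => kC //.
  (* The return path only adds the label of [t] at [c], which already occurs in the minimum giving
     the label of [j] in [u]. *)
  have [jN cC sc e'] := cap_mate_inl e kC.
  have lk : lab u (inr k) = lab u (inl j) by rewrite -e -uE uLm.
  have lc : lab u (flip (mate t (inl j))) = lab t (mate t (inl j)) :> nat.
    by rewrite uL /cap_lab flip_cup // tF tK /= ?inr_cup tL.
  have lj : lab u (inl j) =
      minn (lab t (mate t (inl j))) (lab t (swap_cup i (mate t (inl j)))) :> nat.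
    by rewrite uL /cap_lab (negbTE jN) cC (cup_lab _ cC).
  have -> : minn (lab u (inr (gen_fst i))) (lab u (inr (gen_snd i))) =
     minn (lab u (inr k)) (lab u (flip (mate t (inl j)))).
    move: (cC) sc; rewrite !inE /swap_cup => /orP[]/eqP->.
      by rewrite eqxx => -[<-]; rewrite minnC.
    by rewrite eq_inl gen_snd_neq => -[<-].
  by rewrite lk lc lj; lia.
rewrite uL /cap_lab; case: ifPn => // jC.
have e : mate (mirror u) (inl j) = mate t (inl j).
  rewrite mate_mirror /= uE /cap_mate inr_cup ifF; first by rewrite (tF (inl j)) flipK.
  by apply/negbTE/negP => h; move: (h); rewrite straight_r // (negbTE jC).
rewrite e !lab_mirror /= !uL /cap_lab !inr_cup.
case: ifPn => cC.
  rewrite -!(tL (inl _)) /=.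
  by case: ifP; case: ifP => //; lia.
rewrite ifF; first by rewrite (tL (inl j)).
by apply/negbTE/negP => h; move: (h); rewrite straight_r // (negbTE jC).
Qed.

(* A propagating line of [u] ending at {i, i+1} on the right returns, through *)
(* the right factor G_i, to the mirror image of its left end.                 *)
Lemma conj_gen : comp u (gen i) = unfold_half (left_half u).
Proof.
have uP := comp_gen_well_formed i tP; have mP := mirror_well_formed uP.
rewrite comp_genr //; apply: diagram_eq => v.
  by rewrite mate_mirror mate_comp_gen // mate_conj_gen.
by apply: val_inj; rewrite /= lab_mirror lab_comp_gen // lab_conj_gen.
Qed.

End Conjugation.
End Mirror.

(** * Okada conditions for unfoldings and generators *)

Section Okada.
Variable n : nat.
Implicit Types (d t u : diagram n) (v w a c : vertex n) (i : 'I_n.-1) (j k : 'I_n).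

Lemma pos_inj : injective (@pos n).
Proof.
case=> j [] k /= e; have jn := ltn_ord j; have kn := ltn_ord k; try lia.
  by have -> : j = k by apply: ord_inj; lia.
by have -> : j = k by apply: ord_inj; lia.
Qed.

Lemma card_ord_above (m j : nat) : (\sum_(k < m | j < k) 1 = m - j.+1)%N.
Proof.
rewrite big_mkcond; elim: m => [|m IHm]; first by rewrite big_ord0.
by rewrite big_ord_recr /= IHm; case: ifP; lia.
Qed.

(* The vertices enclosed by the arc are matched among themselves. *)
Lemma propagating_parity d j k : is_okada d -> mate d (inl j) = inr k -> odd j = odd k.
Proof.
move=> dO e; have [dK dN _ _] := okada_well_formed dO.
pose A := [set w : vertex n | (j < pos w)%N && (pos w < pos (inr k : vertex n))%N].
have mA w : w \in A -> mate d w \in A.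
  rewrite !inE => /andP[w1 w2].
  have nj : pos (mate d w) <> j.
    move=> /(@pos_inj _ (inl j)) h; have := dK w; rewrite h e => h'.
    by rewrite h' ltnn in w2.
  have nk : pos (mate d w) <> pos (inr k : vertex n).
    move=> /pos_inj h; have := dK (inl j); rewrite e -h dK => h'.
    by rewrite h' /= ltnn in w1.
  apply/andP; split; rewrite ltnNge; apply/negP => h.
    apply: (@okada_noncrossing _ d (mate d w) (inl j) dO) => /=; rewrite ?dK ?e //.
    by rewrite ltn_neqAle h andbT; apply/eqP.
  apply: (@okada_noncrossing _ d (inl j) w dO) => //=; rewrite e //.
  by rewrite ltn_neqAle h andbT; apply/eqP => /esym.
(* [B] holds the first ends of arcs. [mate d] carries those in [A] onto the rest of [A], so [A] has
   even size, while it has [n - j.+1] left and [n - k.+1] right vertices. *)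
pose B := [set w : vertex n | (pos w < pos (mate d w))%N].
have dI : injective (mate d) := can_inj dK.
have eB : A :\: B = [set mate d w | w in A :&: B].
  apply/setP => w; rewrite !inE; apply/andP/imsetP => [[wB wA]|[x]].
    have wA' : w \in A by rewrite inE.
    exists (mate d w); rewrite ?dK // in_setI mA //= inE dK ltn_neqAle leqNgt wB andbT.
    by apply/eqP => /pos_inj h; have := dN w; rewrite h eqxx.
  rewrite in_setI => /andP[xA]; rewrite inE => xB ->; split; first by rewrite dK; lia.
  by have := mA x xA; rewrite inE.
have : odd #|A| = false.
  by rewrite -(cardsID B A) eB card_imset // addnn odd_double.
rewrite -sum1_card big_sumType /=.
have -> : (\sum_(l < n | inl l \in A) 1 = \sum_(l < n | j < l) 1)%N.
  by apply: eq_bigl => l; rewrite inE /=; have := ltn_ord l; have := ltn_ord k; lia.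
have -> : (\sum_(l < n | inr l \in A) 1 = \sum_(l < n | k < l) 1)%N.
  by apply: eq_bigl => l; rewrite inE /=;
    have := ltn_ord l; have := ltn_ord j; have := ltn_ord k; lia.
rewrite !card_ord_above oddD; have := ltn_ord j; have := ltn_ord k; lia.
Qed.

(** Crossings and nestings are pulled back to [d], right-hand arcs through their mirror images. A
    propagating arc may be made horizontal at [j], because its label is at most the height of [j]
    and has the parity of that height. *)
Lemma unfold_half_okada d : is_okada d -> is_okada (unfold_half (left_half d)).
Proof.
move=> dO; have [dK dN dL dH] := okada_well_formed dO.
have nc a c := @okada_noncrossing _ d a c dO; have ne a c := @okada_nesting _ d a c dO.
have left_sym j k : mate d (inl j) = inl k -> mate d (inl k) = inl j.
  by move=> <-; rewrite dK.
apply/and4P; split.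
- apply/andP; split; apply/forallP => v; last first.
    apply/eqP; rewrite !lab_unfold mate_unfold; case: v => j;
      case e: (mate d (inl j)) => [k|k] //; by rewrite -e dL.
  apply/andP; rewrite !mate_unfold; case: v => j;
    case e: (mate d (inl j)) => [k|k]; rewrite ?(left_sym _ _ e) ?e //.
    by split=> //; have := dN (inl j); rewrite e.
  by split=> //; have := dN (inl j); rewrite e.
- apply/forallP => a; apply/forallP => c; apply/negP; rewrite !mate_unfold => /and3P[].
  case: a c => [j|j] [l|l]; case ej: (mate d (inl j)) => [k|k];
    case el: (mate d (inl l)) => [m|m] /=; have := ltn_ord j; have := ltn_ord k;
    have := ltn_ord l; have := ltn_ord m => jn kn ln mn h1 h2 h3; try lia.
  (* The patterns surviving arithmetic: the first arc on the left; both arcs on the right, where the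
     order reverses; a propagating arc against one on the right. *)
  all: try (by apply: (nc (inl j) (inl l)); rewrite ?ej ?el /=; lia).
  all: try (by apply: (nc (inl m) (inl k)); rewrite ?(left_sym _ _ ej) ?(left_sym _ _ el) /=; lia).
  all: try (by apply: (nc (inl m) (inl j)); rewrite ?ej ?(left_sym _ _ el) /=; lia).
- apply/forallP => v; case/and4P: (dO) => _ _ /forallP dR _.
  rewrite mate_unfold lab_unfold.
  case: v => j; have /and3P[/= l1 l2 /eqP l3] := dR (inl j); rewrite l1 /=;
    case e: (mate d (inl j)) l2 l3 => [k|k] /= l2 l3; rewrite ?l2 ?l3 ?eqxx //;
    have := propagating_parity dO e; lia.
- apply/forallP => a; apply/forallP => c; apply/implyP.
  rewrite !mate_unfold !lab_unfold => /and3P[].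
  case: a c => [j|j] [l|l]; case ej: (mate d (inl j)) => [k|k];
    case el: (mate d (inl l)) => [m|m] /=; have := ltn_ord j; have := ltn_ord k;
    have := ltn_ord l; have := ltn_ord m => jn kn ln mn h1 h2 h3; try lia.
  all: try (by apply: ne; rewrite ?ej ?el /=; lia).
  all: try (by rewrite -(dL (inl j)) ej; apply: ne; rewrite ?(left_sym _ _ ej) ?el /=; lia).
  all: try (by rewrite -(dL (inl j)) -(dL (inl l)) ej el; apply: ne;
    rewrite ?(left_sym _ _ ej) ?(left_sym _ _ el) /=; lia).
  (* Two propagating arcs: the outer one in the unfolding is outer in [d] too, since otherwise they
     would cross there. *)
  case: (ltngtP k m) => [km|mk|/ord_inj km].
  + by case: (nc (inl l) (inl j)); rewrite ?ej ?el /=; lia.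
  + by apply: ne; rewrite ?ej ?el /=; lia.
  + by move: h1; have := dK (inl j); rewrite ej km -el dK => -[->]; rewrite ltnn.
Qed.

(** Describing [gen_mate] by heights and sides turns most of the Okada conditions on G_i into linear
    arithmetic. *)
Lemma gen_mateP i v :
  [\/ [/\ height v = i.+1, height (gen_mate i v) = i.+2 & is_right (gen_mate i v) = is_right v],
      [/\ height v = i.+2, height (gen_mate i v) = i.+1 & is_right (gen_mate i v) = is_right v]
    | [/\ (height v == i.+1) = false, (height v == i.+2) = false & gen_mate i v = flip v]].
Proof.
have fE j : (j == gen_fst i) = (j.+1 == i.+1) by [].
have sE j : (j == gen_snd i) = (j.+1 == i.+2) by [].
by case: v => j /=; rewrite fE sE;
  (case: ifP => e1; first by constructor 1; split; rewrite ?(eqP e1));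
  (case: ifP => e2; first by constructor 2; split; rewrite ?(eqP e2)); by constructor 3.
Qed.

Lemma gen_okada i : is_okada (gen i).
Proof.
have lt_in := ltn_ord i; apply/and4P; split.
- apply/andP; split; apply/forallP => v; last first.
    apply/eqP/val_inj; rewrite /= !lab_gen /gen_lab mate_gen.
    case: (gen_mateP i v) => -[h1 h2 h3]; rewrite ?h1 ?h2 ?h3 ?height_flip ?h2 ?eqxx //;
      case: eqP => ?; lia.
  apply/andP; rewrite !mate_gen; split; last first.
    case: (gen_mateP i v) => -[h1 h2 h3].
    + by apply/eqP => e; rewrite e in h2; lia.
    + by apply/eqP => e; rewrite e in h2; lia.
    + by rewrite h3; case: (v).
  have [vC|vN] := boolP (v \in cup i).
    by rewrite (gen_mate_cup vC) gen_mate_cup ?swap_cup_mem // swap_cupK.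
  have [vC|vN'] := boolP (flip v \in cup i).
    rewrite -{1}(flipK v) (gen_mate_cupr vC) gen_mate_cupr ?swap_cup_mem //.
    by rewrite swap_cupK // flipK.
  by case: v vN vN' => j h1 h2; have [e1 e2] := gen_mateN (i := i) (j := j) ltac:(done);
    rewrite ?e1 ?e2 ?e1.
- apply/forallP => a; apply/forallP => c; apply/negP => /and3P[].
  rewrite !mate_gen !pos_height; have := height_le a; have := height_le c.
  have := height_gt0 a; have := height_gt0 c.
  case: (gen_mateP i a) => -[a1 a2 a3]; case: (gen_mateP i c) => -[c1 c2 c3];
    rewrite ?a1 ?a2 ?a3 ?c1 ?c2 ?c3 ?height_flip ?is_right_flip;
    case: (is_right a); case: (is_right c) => /=; lia.
- apply/forallP => v; rewrite lab_gen /gen_lab mate_gen.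
  have := height_gt0 v.
  case: (gen_mateP i v) => -[h1 h2 h3]; rewrite ?h1 ?h2 ?h3 ?height_flip ?eqxx;
    try (case: eqP => ?); lia.
- apply/forallP => a; apply/forallP => c; apply/implyP => /and3P[].
  rewrite !mate_gen !pos_height !lab_gen /gen_lab; have := height_le a; have := height_le c.
  have := height_gt0 a; have := height_gt0 c.
  case: (gen_mateP i a) => -[a1 a2 a3]; case: (gen_mateP i c) => -[c1 c2 c3];
    rewrite ?a1 ?a2 ?a3 ?c1 ?c2 ?c3 ?height_flip ?is_right_flip;
    rewrite ?a2 ?c2 ?eqxx; case: (is_right a); case: (is_right c) => /=;
    do 2?[case: eqP => ?]; lia.
Qed.

Lemma id_diag_mate v : mate (id_diag n) v = flip v.
Proof. by rewrite /mate ffunE. Qed.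

Lemma id_diag_lab v : lab (id_diag n) v = height v :> nat.
Proof. by rewrite /lab ffunE inordK // ltnS height_le. Qed.

Lemma id_diag_well_formed : well_formed (id_diag n).
Proof.
split=> v; rewrite ?id_diag_mate ?flipK //; first by case: v.
  by apply: val_inj; rewrite /= !id_diag_lab height_flip.
by rewrite id_diag_lab.
Qed.

Lemma comp_gen_id i : comp (gen i) (id_diag n) = gen i.
Proof.
have idP := id_diag_well_formed; apply: diagram_eq => v; last apply: val_inj.
  rewrite mate_comp_gen // mate_gen /cap_mate !id_diag_mate.
  case: ifPn => [/gen_mate_cup//|vN]; case: ifPn => vN'.
    by rewrite -(gen_mate_cupr vN') flipK.
  by case: v vN vN' => j h1 h2; have [e1 e2] := gen_mateN (i := i) (j := j) ltac:(done);
    rewrite ?e1 ?e2.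
rewrite /= lab_comp_gen // lab_gen /cap_lab /gen_lab id_diag_mate !id_diag_lab /=.
have e w : w \in cup i = ~~ is_right w && ((height w == i.+1) || (height w == i.+2)).
  by case: w => j; rewrite !inE.
rewrite !e height_flip is_right_flip; case: (is_right v) => /=;
  do 3?[case: eqP => ? /=]; lia.
Qed.

Lemma gen_inj : injective (@gen n).
Proof.
move=> i j e; have : gen_mate i (inl (gen_fst i)) = gen_mate j (inl (gen_fst i)).
  by rewrite -!mate_gen e.
rewrite /= eqxx.
case: ifPn => [/eqP/(congr1 val) /= h _|_]; first exact: val_inj.
by case: ifPn => // /eqP/(congr1 val) /= h [/=]; lia.
Qed.

Lemma gen_neq_id i : gen i <> id_diag n.
Proof.
move/(congr1 (fun d => mate d (inl (gen_fst i)))).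
by rewrite mate_gen id_diag_mate /= eqxx.
Qed.

(** The generators are distinct and differ from the identity. Uniqueness pins down the word selected
    by [xget], so that E_{G_i} is E_i. *)
Lemma reduced_word_gen i (w : seq 'I_n.-1) : reduced_word (gen i) w <-> w = [:: i].
Proof.
have ri : word_diag [:: i] = gen i by rewrite /= comp_gen_id.
have size1 (w' : seq 'I_n.-1) : word_diag w' = gen i -> (size w' <= 1)%N -> w' = [:: i].
  case: w' => [/esym/gen_neq_id//|j [|//]].
  by rewrite /= comp_gen_id => /gen_inj->.
split=> [[wi wmin]|->].
  exact: size1 wi (wmin _ ri).
by split=> // -[|//] /esym/gen_neq_id.
Qed.

Lemma okada_elt_gen (K : fieldType) (O : algType K) (E : 'I_n.-1 -> O) i :
  okada_elt E (gen i) = E i.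
Proof.
rewrite /okada_elt; set w := classical_sets.xget _ _.
have : reduced_word (gen i) w.
  apply: (@classical_sets.xgetPex _ _ (reduced_word (gen i))).
  by exists [:: i]; apply/reduced_word_gen.
by move/reduced_word_gen->; rewrite big_seq1.
Qed.

End Okada.

(** * Module actions and intertwining maps *)

Section ModuleAction.
Variables (K : fieldType) (A : algType K).

Section Basic.
Variables (W : lmodType K) (act : A -> W -> W).
Hypothesis actP : is_module_action act.

Lemma module_act0 a : act a 0 = 0.
Proof.
have [lin _ _ _] := actP; have := lin a (-1) 0 0.
by rewrite scaler0 add0r scaleN1r addNr.
Qed.

Lemma module_act_sum a (I : finType) (c : I -> K) (v : I -> W) :
  act a (\sum_j c j *: v j) = \sum_j c j *: act a (v j).
Proof.
have [lin _ _ _] := actP; elim/big_rec2: _ => [|j x y _ <-]; first exact: module_act0.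
exact: lin.
Qed.

Lemma module_0act v : act 0 v = 0.
Proof.
have [_ lin _ _] := actP; have := lin (-1) 0 0 v.
by rewrite scaler0 add0r scaleN1r addNr.
Qed.

End Basic.

Lemma intertwining_generators (I : finType) (E : I -> A) (V W : lmodType K)
    (actV : A -> V -> V) (actW : A -> W -> W) (f : {linear V -> W}) :
  (forall a, exists s : seq (K * seq I), a = \sum_(cw <- s) cw.1 *: \prod_(i <- cw.2) E i) ->
  is_module_action actV -> is_module_action actW ->
  (forall i v, f (actV (E i) v) = actW (E i) (f v)) ->
  forall a v, f (actV a v) = actW a (f v).
Proof.
move=> spanE aV aW fE a v; have [s ->] := spanE a.
have [_ linV oneV mulV] := aV; have [_ linW oneW mulW] := aW.
elim: s => [|[c w] s IHs]; first by rewrite big_nil !module_0act // linear0.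
rewrite big_cons linV linW linearP IHs; congr (_ *: _ + _) => {s IHs} /=.
elim: w v => [|i w IHw] v; first by rewrite big_nil oneV oneW.
by rewrite big_cons mulV mulW fE IHw.
Qed.

End ModuleAction.

(** * The linear bijection induced by unfolding *)

Section Isomorphism.
Variables (K : fieldType) (n : nat) (S : {set 'I_n.+1}).

Lemma half_of_subproof (s : sym_index n S) :
  is_okada_half (left_half (val s)) && (plab_half (left_half (val s)) == S).
Proof.
case: s => t /= /and3P[tO _ tS]; rewrite plab_left_half tS andbT.
by apply/existsP; exists t; rewrite tO eqxx.
Qed.

Definition half_of (s : sym_index n S) : half_index n S := 
  exist (fun h => is_okada_half h && (plab_half h == S)) _ (half_of_subproof s).

Lemma sym_of_subproof (h : half_index n S) :
  let t := unfold_half (val h) in [&& is_okada t, t == mirror t & plab t == S].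
Proof.
case: h => h /= /andP[/existsP[d /andP[dO /eqP <-]] hS].
by rewrite unfold_half_okada // mirror_unfold eqxx -plab_left_half left_half_unfold.
Qed.

Definition sym_of (h : half_index n S) : sym_index n S := 
  exist (fun t => [&& is_okada t, t == mirror t & plab t == S]) _ (sym_of_subproof h).

Lemma sym_index_unfold (s : sym_index n S) : unfold_half (left_half (val s)) = val s.
Proof.
case: s => t /= /and3P[tO /eqP tM _].
by apply: unfold_left_half => //; apply: symmetric_straight.
Qed.

Lemma half_ofK : cancel half_of sym_of.
Proof. by move=> s; apply: val_inj; rewrite /= sym_index_unfold. Qed.

Lemma sym_ofK : cancel sym_of half_of.
Proof.
move=> h; apply: val_inj => /=; case: h => h /= /andP[/existsP[d /andP[_ /eqP <-]] _].
exact: left_half_unfold.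
Qed.

Definition cell_to_sym (v : cell_space K S) : sym_space K S :=
  [ffun s => (v : {ffun half_index n S -> K^o}) (half_of s)].

Lemma cell_to_sym_is_linear : linear cell_to_sym.
Proof. by move=> c v w; apply/ffunP => s; rewrite !ffunE. Qed.

HB.instance Definition _ := GRing.isLinear.Build K (cell_space K S) (sym_space K S) _
  cell_to_sym cell_to_sym_is_linear.

Lemma cell_to_sym_bij : bijective cell_to_sym.
Proof.
exists (fun v : sym_space K S =>
  [ffun h => (v : {ffun sym_index n S -> K^o}) (sym_of h)] : cell_space K S) => v;
  by apply/ffunP => s; rewrite !ffunE ?sym_ofK ?half_ofK.
Qed.

(** An index is the unfolding of the left half of [d] exactly when it has the same left half. If no
    index qualifies, both vectors are zero, so this applies directly to [comp (gen i) t]. *)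
Lemma cell_to_sym_vec (d : diagram n) :
  cell_to_sym (cell_vec K S (left_half d)) = sym_vec K S (unfold_half (left_half d)).
Proof.
apply/ffunP => s; rewrite !ffunE /=; congr (nat_of_bool _)%:R; apply/eqP/eqP => [<-|->].
  by rewrite sym_index_unfold.
exact: left_half_unfold.
Qed.

Lemma cell_vec_span (v : cell_space K S) :
  v = \sum_(s : half_index n S)
        (v : {ffun half_index n S -> K^o}) s *: cell_vec K S (val s).
Proof.
apply/ffunP => h; rewrite sum_ffunE (bigD1 h) //= big1 => [|s sh].
  by rewrite !ffunE eqxx addr0 [_ *: _]mulr1.
by rewrite !ffunE (inj_eq val_inj) eq_sym (negbTE sh) [_ *: _]mulr0.
Qed.

End Isomorphism.

Theorem proposition7p3
    (K0 K : fieldType) (iota : {rmorphism K0 -> K}) (x y : nat -> K)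
    (n : nat) (O : algType K) (E : 'I_n.-1 -> O) (S : {set 'I_n.+1})
    (actV : O -> cell_space K S -> cell_space K S)
    (actM : O -> sym_space K S -> sym_space K S) :
  [pchar K0] =i pred0 ->
  generic_parameters iota x y ->
  (1 <= n)%N ->
  is_okada_algebra x y E ->
  fibonacci_set S ->
  is_cell_module E actV ->
  is_sym_module E actM ->
  module_isomorphic actV actM.
Proof.
move=> _ _ _ [_ spanE _] _ [aV cellV] [aM symM].
exists (@cell_to_sym K n S); split; first exact: cell_to_sym_bij.
apply: (intertwining_generators spanE aV aM) => i v.
rewrite (cell_vec_span v) (module_act_sum aV) !linear_sum /=.
rewrite (eq_bigr _ (fun s _ => linearZ _ _)); under [in RHS]eq_bigr do rewrite linearZ.
rewrite (module_act_sum aM); apply: eq_bigr => h _; congr (_ *: _).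
(* Evaluating the cell action on the symmetric representative [t] makes both sides carry
   [lambda E (gen i) t]. *)
rewrite -(sym_ofK h); case: (sym_of h) => t /= tP.
have /and3P[tO /eqP tM /eqP tS] := tP.
have tW := okada_well_formed tO; have tSt := symmetric_straight tO tM.
rewrite cell_to_sym_vec unfold_left_half // -(okada_elt_gen E i).
rewrite (cellV _ _ (gen_okada i) tO tS) (symM _ _ (gen_okada i) tO tM tS).
(* Propagating labels depend only on the left half, so both actions vanish under the same
   condition. *)
rewrite mirror_gen conj_gen // -[in RHS]plab_left_half left_half_unfold plab_left_half.
by case: ifP => _; rewrite ?linear0 // linearZ /= cell_to_sym_vec.
Qed.
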